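(* Let $G=\mathbb{R}\rtimes\mathbb{R}^\times$. If $p\in(1,2)\cup(2,\infty)$, then $\mathrm{A}_p(G)\not\subseteq\mathrm{A}^p_\pi$.
   Context: $\mathbb{R}^\times$ is the multiplicative group of non-zero reals with Haar measure $dt/|t|$, and $L^p(\mathbb{R}^\times)$ is taken with respect to this measure; $q$ is the conjugate index to $p$; $\widehat{\otimes}$ is the projective tensor product. $G=\mathbb{R}\rtimes\mathbb{R}^\times=\{(b,a):b\in\mathbb{R},a\in\mathbb{R}^\times\}$ with the product topology and multiplication $(b,a)(b',a')=(ab'+b,aa')$. $\mathrm{A}^p_\pi\subset C_0(G)$ is the range of the contractive linear map $\Psi_p$ on $L^p(\mathbb{R}^\times)\widehat{\otimes}L^q(\mathbb{R}^\times)$ determined by $\Psi_p(\xi\otimes\eta)(b,a)=\int_{\mathbb{R}^\times}e^{2\pi i bt}\xi(ta)\eta(t)\,\frac{dt}{|t|}$, equipped with the quotient norm. $\mathrm{A}_p(G)$ is the Figà-Talamanca–Herz algebra, defined as the coefficient space of the left regular representation of $G$ on $L^p(G)$: the range of the map $L^p(G)\widehat{\otimes}L^q(G)\to C_b(G)$ sending $\xi\otimes\eta$ to $x\mapsto\langle\lambda_p(x)\xi,\eta\rangle$ (bilinear pairing, $\lambda_p(x)\xi(y)=\xi(x^{-1}y)$, left Haar measure), equipped with the quotient norm. *)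

(* Defs.v *)
From HB Require Import structures.
From mathcomp Require Import all_boot all_order all_algebra.
From mathcomp Require Import complex ring.
From mathcomp Require Import all_classical all_reals all_analysis measurable_realfun.
Set Implicit Arguments.
Unset Strict Implicit.
Unset Printing Implicit Defensive.
Import Order.TTheory GRing.Theory Num.Theory.
Import numFieldNormedType.Exports.
Import ComplexField.Normc.
Local Open Scope classical_set_scope.
Local Open Scope ring_scope.
Local Open Scope complex_scope.

Record rstar (R : realType) := Rstar { rval : R; rval_neq0 : rval != 0 }.

HB.instance Definition _ (R : realType) := [isSub for @rval R].
HB.instance Definition _ (R : realType) := [Choice of rstar R by <:].

Section rstar.
Context {R : realType}.
Implicit Types s t : rstar R.

Lemma rval_inj : injective (@rval R). Proof. exact: val_inj. Qed.

Definition rstar_one : rstar R := Rstar (oner_neq0 R).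
Definition rstar_mul s t : rstar R :=
  Rstar (mulf_neq0 (rval_neq0 s) (rval_neq0 t)).
Definition rstar_inv s : rstar R := Rstar (invr_neq0 (rval_neq0 s)).

Lemma rstar_mulA : associative rstar_mul.
Proof. by move=> s t u; apply: rval_inj; exact: mulrA. Qed.
Lemma rstar_mul1 : left_id rstar_one rstar_mul.
Proof. by move=> s; apply: rval_inj; exact: mul1r. Qed.
Lemma rstar_mulr1 : right_id rstar_one rstar_mul.
Proof. by move=> s; apply: rval_inj; exact: mulr1. Qed.
Lemma rstar_mulV : left_inverse rstar_one rstar_inv rstar_mul.
Proof. by move=> s; apply: rval_inj; exact: mulVf (rval_neq0 s). Qed.
Lemma rstar_mulrV : right_inverse rstar_one rstar_inv rstar_mul.
Proof. by move=> s; apply: rval_inj; exact: mulfV (rval_neq0 s). Qed.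

HB.instance Definition _ := isGroup.Build (rstar R)
  rstar_mulA rstar_mul1 rstar_mulr1 rstar_mulV rstar_mulrV.

HB.instance Definition _ := isPointed.Build (rstar R) rstar_one.
HB.instance Definition _ := Measurable.copy (rstar R)
  (g_sigma_algebra_preimageType (@rval R : rstar R -> measurableTypeR R)).

End rstar.

(* The pair (b, a) is the affine map t |-> a t + b. *)
Definition affine (R : realType) : Type := (measurableTypeR R * rstar R)%type.

Section affine.
Context {R : realType}.
Implicit Types x y : affine R.

HB.instance Definition _ := Choice.on (affine R).
HB.instance Definition _ := Measurable.on (affine R).

Definition affine_one : affine R := (0, 1%g).
Definition affine_mul x y : affine R :=
  (rval x.2 * y.1 + x.1, (x.2 * y.2)%g).
Definition affine_inv x : affine R :=
  (- ((rval x.2)^-1 * x.1), (x.2^-1)%g).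

Lemma affine_mulA : associative affine_mul.
Proof.
move=> x y z; rewrite /affine_mul /= mulgA; congr pair.
by rewrite mulrDr mulrA addrA.
Qed.
Lemma affine_mul1 : left_id affine_one affine_mul.
Proof. by move=> [b a]; rewrite /affine_mul /= mul1g mul1r addr0. Qed.
Lemma affine_mulr1 : right_id affine_one affine_mul.
Proof. by move=> [b a]; rewrite /affine_mul /= mulg1 mulr0 add0r. Qed.
Lemma affine_mulV : left_inverse affine_one affine_inv affine_mul.
Proof. by move=> [b a]; rewrite /affine_mul /= mulVg subrr. Qed.
Lemma affine_mulrV : right_inverse affine_one affine_inv affine_mul.
Proof.
move=> [b a]; rewrite /affine_mul /= mulgV mulrN mulrA mulfV ?rval_neq0//.
by rewrite mul1r addNr.
Qed.

HB.instance Definition _ := isGroup.Build (affine R)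
  affine_mulA affine_mul1 affine_mulr1 affine_mulV affine_mulrV.

Definition affine_coord x : measurableTypeR R * measurableTypeR R :=
  (x.1, rval x.2).

End affine.

Section weighted_image.
Local Open Scope ereal_scope.
Context {d1 d2 : measure_display} {T1 : measurableType d1}
  {T2 : measurableType d2} {R : realType}.
Variables (nu : {measure set T2 -> \bar R}) (f : T1 -> T2) (w : T2 -> R).

Definition weighted_image (A : set T1) : \bar R :=
  \int[nu]_(z in f @` A) (w z)%:E.

Variables (D : set T2) (g : T2 -> T1).
Hypotheses (mD : measurable D) (mg : measurable_fun setT g).
Hypotheses (fK : cancel f g) (fD : forall x, D (f x)).
Hypothesis gK : forall z, D z -> f (g z) = z.

Lemma image_retract (A : set T1) : f @` A = D `&` g @^-1` A.
Proof.
apply/seteqP; split=> [_ [x Ax <-]|z [Dz Az]]; last by exists (g z); rewrite ?gK.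
by split; [exact: fD|rewrite /preimage /= fK].
Qed.

Lemma measurable_image_retract (A : set T1) : measurable A -> measurable (f @` A).
Proof.
move=> mA; rewrite image_retract; apply: measurableI => //.
by rewrite -[X in measurable X]setTI; exact: mg.
Qed.

Hypotheses (w0 : forall z, (0 <= w z)%R) (mw : measurable_fun setT w).

Lemma weighted_image0 : weighted_image set0 = 0.
Proof. by rewrite /weighted_image image_set0 integral_set0. Qed.

Lemma weighted_image_ge0 A : 0 <= weighted_image A.
Proof. by apply: integral_ge0 => z _; rewrite lee_fin. Qed.

Lemma weighted_image_sigma_additive : semi_sigma_additive weighted_image.
Proof.
move=> F mF tF mUF.
have -> : weighted_image (\bigcup_n F n) = \sum_(n <oo) weighted_image (F n).
  rewrite /weighted_image image_bigcup; apply: ge0_integral_bigcup.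
  - by move=> k; exact: measurable_image_retract.
  - apply: (@measurable_funS _ _ _ _ setT) => //; exact/measurable_EFinP.
  - by move=> z _; rewrite lee_fin.
  - move=> m n _ _ [_ [[x Fx <-] [y Fy /(can_inj fK) xy]]].
    by apply: tF => //; exists x; split => //; rewrite -xy.
apply/cvg_closeP; split; last by rewrite closeE.
by apply: is_cvg_nneseries => n _ _; exact: weighted_image_ge0.
Qed.

End weighted_image.

Lemma measurable_invr_ge0 d (T : measurableType d) (R : realType) (f : T -> R) :
  (forall x, 0 <= f x) -> measurable_fun setT f ->
  measurable_fun setT (fun x => (f x)^-1).
Proof.
move=> f0 mf; apply: (eq_measurable_fun (fun x => f x `^ (-1))).
  by move=> x _; rewrite powR_inv1.
exact: (measurableT_comp (measurable_powR (-1))) mf.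
Qed.

Section haar.
Context {R : realType}.

Let nonzero : set (measurableTypeR R) := [set t | t != 0].
Let retract (t : measurableTypeR R) : rstar R := insubd (1%g : rstar R) t.

Let measurable_nonzero : measurable nonzero.
Proof.
rewrite (_ : nonzero = ~` [set 0]); first exact: measurableC.
by apply/seteqP; split=> t /eqP.
Qed.

Let rvalK : cancel (@rval R) retract.
Proof. exact: valKd. Qed.

Let retractK t : nonzero t -> rval (retract t) = t.
Proof. by move=> t0; rewrite /retract val_insubd t0. Qed.

Let measurable_retract : measurable_fun setT retract.
Proof.
move=> _ _ [B mB <-]; rewrite !setTI -comp_preimage.
rewrite (_ : _ @^-1` _ = (nonzero `&` B) `|`
    (~` nonzero `&` [set _ | B 1])); last first.
  apply/seteqP; split=> t /=.
  - rewrite /preimage /= /retract val_insubd.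
    by case: ifPn => t0 Bt; [left|right; split => //; exact/negP].
  - rewrite /preimage /= /retract val_insubd.
    by move=> [[t0 Bt]|[/negP/negbTE -> B1]] //; rewrite ifT.
apply: measurableU; first exact: measurableI.
apply: measurableI; first exact: measurableC.
by have [B1|B1] := pselect (B 1);
  [rewrite (_ : [set _ | _] = setT)|rewrite (_ : [set _ | _] = set0)] => //;
  apply/seteqP; split.
Qed.

Definition haar_rstar : set (rstar R) -> \bar R :=
  weighted_image lebesgue_measure
    (@rval R : rstar R -> measurableTypeR R) (fun t => `|t|^-1).

Let haar_rstar_weight_ge0 (t : measurableTypeR R) : 0 <= `|t|^-1.
Proof. by rewrite invr_ge0. Qed.

Let haar_rstar_sigma_additive : semi_sigma_additive haar_rstar.
Proof.
apply: (weighted_image_sigma_additive measurable_nonzero measurable_retract).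
- exact: rvalK.
- exact: rval_neq0.
- exact: retractK.
- exact: haar_rstar_weight_ge0.
- exact: measurable_invr_ge0.
Qed.

HB.instance Definition _ := isMeasure.Build _ _ _ haar_rstar
  (weighted_image0 _ _ _) (weighted_image_ge0 _ _ haar_rstar_weight_ge0)
  haar_rstar_sigma_additive.

Definition haar_affine : set (affine R) -> \bar R :=
  weighted_image (lebesgue_measure \x lebesgue_measure)%E
    (@affine_coord R) (fun z => (z.2 ^+ 2)^-1).

Let haar_affine_weight_ge0 (z : measurableTypeR R * measurableTypeR R) :
  0 <= (z.2 ^+ 2)^-1.
Proof. by rewrite invr_ge0 sqr_ge0. Qed.

Let pair_retract (z : measurableTypeR R * measurableTypeR R) : affine R :=
  (z.1, retract z.2).

Let measurable_pair_retract : measurable_fun setT pair_retract.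
Proof. apply: measurable_fun_pair => //; exact: measurableT_comp. Qed.

Let pair_retractK : cancel affine_coord pair_retract.
Proof. by move=> [b a]; rewrite /pair_retract /= rvalK. Qed.

Let measurable_pair_nonzero :
  measurable ([set: measurableTypeR R] `*` nonzero).
Proof. exact: measurableX. Qed.

Let affine_coord_nonzero (x : affine R) : (setT `*` nonzero) (affine_coord x).
Proof. by case: x => [b a]; split => //; exact: rval_neq0. Qed.

Let affine_coordK z : (setT `*` nonzero) z ->
  affine_coord (pair_retract z) = z.
Proof.
by case: z => [b a] [_ /= a0]; rewrite /affine_coord /= retractK.
Qed.

Lemma measurable_rval (A : set (rstar R)) : measurable A ->
  measurable ((@rval R : rstar R -> measurableTypeR R) @` A).
Proof.
exact: (measurable_image_retract measurable_nonzero measurable_retract rvalK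
  (@rval_neq0 R) retractK).
Qed.

Lemma measurable_affine_coord (A : set (affine R)) : measurable A ->
  measurable (affine_coord @` A).
Proof.
exact: (measurable_image_retract measurable_pair_nonzero
  measurable_pair_retract pair_retractK affine_coord_nonzero affine_coordK).
Qed.

Let haar_affine_sigma_additive : semi_sigma_additive haar_affine.
Proof.
apply: (weighted_image_sigma_additive measurable_pair_nonzero
  measurable_pair_retract pair_retractK affine_coord_nonzero affine_coordK).
- exact: haar_affine_weight_ge0.
- apply: measurable_invr_ge0; first by move=> z; exact: sqr_ge0.
  by apply: measurable_funX; exact: measurable_snd.
Qed.

HB.instance Definition _ := isMeasure.Build _ _ _ haar_affine
  (weighted_image0 _ _ _) (weighted_image_ge0 _ _ haar_affine_weight_ge0)
  haar_affine_sigma_additive.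

End haar.

Section haar_invariance.
Local Open Scope ereal_scope.
Context {R : realType}.
Notation mR := (measurableTypeR R).
Notation leb := (@lebesgue_measure R).

Let aff (c e : R) : mR -> mR := fun t => (c * t + e)%R.

Let measurable_aff c e : measurable_fun setT (aff c e).
Proof. by apply: measurable_funD => //; apply: measurable_funM. Qed.

Let push c e : {measure set mR -> \bar R} :=
  measure_function_pushforward__canonical__measure_function_Measure leb
    (measurable_aff c e).

Section lebesgue_aff_pos.
Variables (c e : R).
Hypothesis c0 : (0 < c)%R.

Lemma lebesgue_aff_pos A : measurable A -> leb A = c%:E * leb (aff c e @^-1` A).
Proof.
pose k : {nonneg R} := NngNum (ltW c0).
move=> mA.
apply: (@lebesgue_measure_unique R (mscale k (push c e))) => // _ [[a b]] _ <-.
change (leb `]a, b]%classic = c%:E * leb (aff c e @^-1` `]a, b]%classic)).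
rewrite (_ : _ @^-1` _ = `]((a - e) / c)%R, ((b - e) / c)%R]%classic); last first.
  apply/seteqP; split=> t; rewrite /= !in_itv /= /aff ltr_pdivrMr// ler_pdivlMr//;
    by rewrite ltrBlDr lerBrDr mulrC.
rewrite !lebesgue_measure_itv/= !lte_fin ltr_pM2r ?invr_gt0// ltrD2r.
case: ifPn => ab; last by rewrite mule0.
rewrite -!EFinB -EFinM; congr EFin; field.
by rewrite gt_eqF.
Qed.
End lebesgue_aff_pos.

Let lebesgue_aff c e A : (c != 0)%R -> measurable A ->
  leb A = `|c|%:E * leb (aff c e @^-1` A).
Proof.
rewrite neq_lt => /orP[c0|c0] mA; last by rewrite gtr0_norm// -lebesgue_aff_pos.
have c0' : (0 < - c)%R by rewrite oppr_gt0.
rewrite ltr0_norm// (lebesgue_aff_pos e c0' mA); congr (_ * _).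
rewrite -lebesgue_measureN; last first.
  by rewrite -[X in measurable X]setTI; exact: measurable_aff.
rewrite /pushforward; congr (leb _).
by apply/seteqP; split=> t; rewrite /= /aff mulrNN.
Qed.

Lemma ge0_integral_aff (c e : R) (h : mR -> \bar R) : (c != 0)%R ->
  measurable_fun setT h -> (forall t, 0 <= h t) ->
  \int[leb]_t h t = `|c|%:E * \int[leb]_t h (c * t + e)%R.
Proof.
move=> c0 mh h0.
pose k : {nonneg R} := NngNum (normr_ge0 c).
transitivity (\int[mscale k (push c e)]_t h t).
  by apply: eq_measure_integral => A mA _; exact: (lebesgue_aff e).
rewrite ge0_integral_mscale//; congr (_ * _).
by rewrite (ge0_integral_pushforward (measurable_aff c e)).
Qed.

Lemma haar_rstar_invariant (s : rstar R) (A : set (rstar R)) : measurable A ->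
  haar_rstar [set (s * t)%g | t in A] = haar_rstar A.
Proof.
move=> mA; rewrite /haar_rstar /weighted_image.
set E := [set rval t | t in A].
pose w (t : mR) := (`|t|^-1)%:E.
pose h := (w \_ E).
have mE : measurable E by exact: measurable_rval.
have s0 := rval_neq0 s; set r := rval s in s0.
have mw : measurable_fun setT w.
  by apply/measurable_EFinP; apply: measurable_invr_ge0.
have mh : measurable_fun setT h.
  by apply/(measurable_restrictT _ mE); exact: measurable_funTS.
have h0 z : 0 <= h z by apply: erestrict_ge0 => y _; rewrite lee_fin invr_ge0.
rewrite [LHS]integral_mkcond [RHS]integral_mkcond -/h -/w.
have r0 : (r^-1 != 0)%R by rewrite invr_eq0.
rewrite [RHS](@ge0_integral_aff r^-1%R 0%R)// -ge0_integralZl//; last first.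
  apply: measurableT_comp => //.
  by apply: measurable_funD => //; apply: measurable_funM.
apply: eq_integral => t _; rewrite /h /patch.
have -> : (t \in [set rval t | t in [set (s * t)%g | t in A]]) =
  ((r^-1 * t + 0)%R \in E).
  apply/idP/idP; rewrite !inE.
  - move=> [_ [y Ay <-] <-]; exists y => //=; rewrite -/r; field.
    exact: s0.
  - move=> [y Ay yt]; exists (s * y)%g; first by exists y.
    by rewrite /= yt -/r; field.
case: ifPn => _; last by rewrite mule0.
rewrite /w -EFinM addr0 normrM invfM mulrA mulfV ?mul1r//.
by rewrite normr_eq0.
Qed.

Lemma haar_affine_left_invariant (x : affine R) (A : set (affine R)) :
  measurable A -> haar_affine [set (x * y)%g | y in A] = haar_affine A.
Proof.
move=> mA; rewrite /haar_affine /weighted_image.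
case: x => b a.
set E := [set affine_coord y | y in A].
pose w (z : mR * mR) := ((z.2 ^+ 2)^-1)%:E.
pose h := (w \_ E).
have mE : measurable E by exact: measurable_affine_coord.
have a0 := rval_neq0 a; set r := rval a in a0.
have mw : measurable_fun setT w.
  apply/measurable_EFinP; apply: measurable_invr_ge0; first by move=> z; exact: sqr_ge0.
  by apply: measurable_funX; exact: measurable_snd.
have mh : measurable_fun setT h.
  by apply/(measurable_restrictT _ mE); exact: measurable_funTS.
have h0 z : 0 <= h z.
  by apply: erestrict_ge0 => y _; rewrite lee_fin invr_ge0 sqr_ge0.
rewrite [LHS]integral_mkcond [RHS]integral_mkcond -/h -/w.
rewrite (_ : _ \_ _ = fun z => ((r ^+ 2)^-1)%:E *
    h (r^-1 * z.1 + (- (r^-1 * b)), r^-1 * z.2 + 0)%R); last first.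
  apply/funext => z; rewrite /h /patch.
  have -> : (z \in [set affine_coord y | y in [set (((b, a) : affine R) * y)%g | y in A]]) =
    ((r^-1 * z.1 + (- (r^-1 * b)), r^-1 * z.2 + 0)%R \in E).
    apply/idP/idP; rewrite !inE.
    - move=> [_ [y Ay <-] <-]; exists y => //.
      by rewrite /affine_coord /=; congr pair; rewrite -/r; field.
    - move=> [y Ay yz]; exists (((b, a) : affine R) * y)%g; first by exists y.
      case: z yz => z1 z2 [/= y1 y2]; congr pair => /=; rewrite -/r.
        by rewrite y1; field.
      by rewrite y2; field.
  case: ifPn => _; last by rewrite mule0.
  rewrite /w /= -EFinM; congr EFin; rewrite addr0 exprMn exprVn (invfM (r ^- 2)) invrK mulrA.
  by rewrite mulVf ?mul1r// sqrf_eq0.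
have mh' (c d : R) : measurable_fun setT
    (fun z : mR * mR => h (c * z.1 + d, c * z.2 + 0)%R).
  apply: measurableT_comp => //; apply: measurable_fun_pair => /=;
    by apply: measurable_funD => //; apply: measurable_funM.
rewrite ge0_integralZl//; last by rewrite lee_fin invr_ge0 sqr_ge0.
set d := (- (r^-1 * b))%R.
have r0 : (r^-1 != 0)%R by rewrite invr_eq0.
rewrite (@fubini_tonelli2 _ _ _ _ _ leb leb _ (mh' r^-1%R d)) => [|z]; last exact: h0.
rewrite (@fubini_tonelli2 _ _ _ _ _ leb leb h) //.
have mk : measurable_fun setT
    (fun z : mR * mR => h (r^-1 * z.1 + d, z.2)%R).
  apply: measurableT_comp => //; apply: measurable_fun_pair => //=.
  by apply: measurable_funD => //; apply: measurable_funM.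
have mG : measurable_fun setT (fun y => \int[leb]_x h (r^-1 * x + d, y)%R).
  exact: (@measurable_fun_fubini_tonelli_G _ _ _ _ _ leb _ mk
    (fun z => h0 _)).
have -> : \int[leb]_y fubini_G leb h y =
    `|r^-1|%R%:E * \int[leb]_y \int[leb]_x h (r^-1 * x + d, y)%R.
  rewrite -ge0_integralZl// => [|y _]; last by apply: integral_ge0 => x _; exact: h0.
  apply: eq_integral => y _; rewrite /fubini_G /=.
  by apply: (@ge0_integral_aff r^-1%R d (fun x => h (x, y))) => //; exact: measurableT_comp.
rewrite (@ge0_integral_aff r^-1%R 0%R (fun y => \int[leb]_x h (r^-1 * x + d, y)%R)) //; last first.
  by move=> y; apply: integral_ge0 => x _; exact: h0.
rewrite muleA -EFinM; congr (_%:E * _).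
by rewrite normfV -invfM -expr2 real_normK// num_real.
Qed.

End haar_invariance.

Section complex_Lp.
Context {d : measure_display} {T : measurableType d} {R : realType}.
Variable mu : {measure set T -> \bar R}.
Implicit Types (p : \bar R) (f : T -> R[i]).

Definition cLnorm p f : \bar R := Lnorm mu p (fun x => (normc (f x))%:E).

(* Functions are not identified modulo mu-a.e. equality here; cLnorm is a
   seminorm on [cLp p], and a.e. equal functions are identified in
   [tensor_equiv] below. *)
Definition cLp p : set (T -> R[i]) :=
  [set f | [/\ measurable_fun setT (fun x => complex.Re (f x)),
               measurable_fun setT (fun x => complex.Im (f x)) &
               (cLnorm p f < +oo)%E]].

Definition cintegral f : R[i] :=
  (\int[mu]_x complex.Re (f x))%R +i* (\int[mu]_x complex.Im (f x))%R.

End complex_Lp.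

Section projective_tensor.
Context {d : measure_display} {T : measurableType d} {R : realType}.
Variables (mu : {measure set T -> \bar R}) (p q : \bar R).
Implicit Types (f g : T -> R[i]) (s t : seq ((T -> R[i]) * (T -> R[i]))).

(* A finite sequence [:: (f1, g1); ...; (fn, gn)] stands for the element
   f1 (x) g1 + ... + fn (x) gn of the algebraic tensor product of L^p(mu) and
   L^q(mu); complex coefficients are absorbed in the first factors. *)
Definition is_tensor s : Prop :=
  forall z, z \in s -> cLp mu p z.1 /\ cLp mu q z.2.

(* Bilinear forms on L^p(mu) x L^q(mu), seen as forms on functions: the last
   condition says that the form depends on the a.e. classes only. *)
Definition bilinear_form (B : (T -> R[i]) -> (T -> R[i]) -> R[i]) : Prop :=
  [/\ forall c f f' g, cLp mu p f -> cLp mu p f' -> cLp mu q g ->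
        B (fun x => c * f x + f' x) g = c * B f g + B f' g,
      forall c f g g', cLp mu p f -> cLp mu q g -> cLp mu q g' ->
        B f (fun x => c * g x + g' x) = c * B f g + B f g' &
      forall f g, cLp mu p f -> cLp mu q g ->
        cLnorm mu p f = 0%E \/ cLnorm mu q g = 0%E -> B f g = 0].

(* Equality in the algebraic tensor product: the canonical map from the
   tensor product of two vector spaces to the dual of the space of bilinear
   forms is injective. *)
Definition tensor_equiv s t : Prop :=
  forall B, bilinear_form B ->
    \sum_(z <- s) B z.1 z.2 = \sum_(z <- t) B z.1 z.2.

Definition tensor_sub s t := s ++ [seq (fun x => - z.1 x, z.2) | z <- t].

Definition projective_norm s : R :=
  inf [set \sum_(z <- t) fine (cLnorm mu p z.1) * fine (cLnorm mu q z.2)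
      | t in [set t | is_tensor t /\ tensor_equiv s t]].

Definition tensor_cauchy (w : nat -> seq ((T -> R[i]) * (T -> R[i]))) : Prop :=
  forall e : R, 0 < e -> exists N : nat, forall m n : nat,
    (N <= m)%N -> (N <= n)%N -> projective_norm (tensor_sub (w m) (w n)) < e.

(* The range of the continuous linear map, from the completion of the
   algebraic tensor product for [projective_norm] to the bounded functions on
   X with the uniform norm, that extends f (x) g |-> Phi f g.  An element of
   the completion is the limit of a Cauchy sequence w of algebraic tensors,
   and its image is the uniform limit of the images of the w n. *)
Definition projective_range {X : Type}
    (Phi : (T -> R[i]) -> (T -> R[i]) -> X -> R[i]) : set (X -> R[i]) :=
  [set u | exists w,
    [/\ forall n, is_tensor (w n),
        tensor_cauchy w &
        forall e : R, 0 < e -> exists N : nat, forall n : nat, (N <= n)%N ->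
          forall x, normc (u x - \sum_(z <- w n) Phi z.1 z.2 x) <= e]].

End projective_tensor.

Section algebras.
Context {R : realType}.

Definition cis (t : R) : R[i] := cos t +i* sin t.

Definition wavelet_coef (xi eta : rstar R -> R[i]) (x : affine R) : R[i] :=
  cintegral haar_rstar (fun t =>
    cis (2 * pi * x.1 * rval t) * xi (t * x.2)%g * eta t).

Definition regular_coef (xi eta : affine R -> R[i]) (x : affine R) : R[i] :=
  cintegral haar_affine (fun y => xi (x^-1 * y)%g * eta y).

Definition A_pi (p : R) : set (affine R -> R[i]) :=
  projective_range haar_rstar p%:E (hoelder_conjugate p%:E) wavelet_coef.

Definition figa_talamanca_herz (p : R) : set (affine R -> R[i]) :=
  projective_range haar_affine p%:E (hoelder_conjugate p%:E) regular_coef.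

End algebras.

(* Main.v *)
Require Import Defs.
From mathcomp Require Import all_boot all_order all_algebra.
From mathcomp Require Import complex ring lra zify.
From mathcomp Require Import all_classical all_reals all_analysis.
From mathcomp Require Import measurable_realfun.
Set Implicit Arguments.
Unset Strict Implicit.
Unset Printing Implicit Defensive.
Import Order.TTheory GRing.Theory Num.Theory.
Import ComplexField.Normc.
Local Open Scope classical_set_scope.
Local Open Scope ring_scope.
Local Open Scope complex_scope.

(** On the subgroup of the points (b, 1), a function of [A_pi] is the Fourier
    transform of an integrable function, because the product of a function in
    L^p and one in L^q is integrable and its values at (b, 1) are integrals of
    this product against e^(2 pi i b t).  On the other hand the left
    translations by (b, 1) act on the first coordinate like the translations of
    the real line, so the restriction of [figa_talamanca_herz] contains
    coefficients of the regular representation of the line on L^p, and for p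
    other than 2 these are not all Fourier transforms of integrable functions.

    The two behaviours are separated by the Rudin-Shapiro signs e_j.  The
    polynomials sum_(j < N) e_j z^j, with N = 2^n, are bounded by sqrt (2 N) on
    the unit circle ([normc_rs_poly]).  Hence, for u in [A_pi], the sums
    sum_(j < N) e_j u (j, 1) are O(sqrt N) ([A_pi_rudin_shapiro]): for each N
    the sum is a bilinear form on L^p x L^q bounded by a multiple of sqrt N, and
    such bounds pass to the projective tensor product
    ([projective_range_bounded]).

    For the counterexample, let s be the larger of p and its conjugate exponent,
    so that s > 2, and cut [0, +oo) x [1, 2] into the boxes [j, j+1) x [1, 2],
    all of the same Haar measure ([box_massE]).  The indicator of the box of
    index 0 and the function with value e_j w_j on the box of index j (or of
    index -j, when p > 2) have a coefficient equal to a constant times e_j w_j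
    at (j, 1) ([step_regular_coef]).  Its signed sum is a constant times the sum
    of the w_j, and w can be chosen in l^s with sums that outgrow sqrt N because
    s > 2 ([exists_decay_rate]).  One elementary tensor is thus enough. *)

(** * Complex moduli and integrals *)

Section modulus.
Context {R : realType}.
Implicit Types z w : R[i].

Lemma normc_ge0 z : 0 <= normc z.
Proof. by case: z => a b; exact: sqrtr_ge0. Qed.

Lemma ler_normcD z w : normc (z + w) <= normc z + normc w.
Proof. exact: (@le_normcD R). Qed.

Lemma ler_normc_sum n (F : 'I_n -> R[i]) :
  normc (\sum_(j < n) F j) <= \sum_(j < n) normc (F j).
Proof.
elim/big_ind2 : _ => [|x1 x2 y1 y2 le1 le2|//]; first by rewrite normc0.
by apply: le_trans (ler_normcD _ _) _; exact: lerD.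
Qed.

Lemma ler_normc_Re z : `|complex.Re z| <= normc z.
Proof. by case: z => a b /=; rewrite -sqrtr_sqr ler_wsqrtr// lerDl sqr_ge0. Qed.

Lemma ler_normc_Im z : `|complex.Im z| <= normc z.
Proof. by case: z => a b /=; rewrite -sqrtr_sqr ler_wsqrtr// lerDr sqr_ge0. Qed.

Lemma ler_normc_ReIm z : normc z <= `|complex.Re z| + `|complex.Im z|.
Proof.
case: z => a b /=.
rewrite -[leRHS]ger0_norm ?addr_ge0// -sqrtr_sqr ler_wsqrtr// sqrrD.
by rewrite !real_normK ?num_real// lerD2r lerDl mulrn_wge0// mulr_ge0.
Qed.

End modulus.

Section complex_measurability.
Context {d : measure_display} {T : measurableType d} {R : realType}.
Implicit Types f g : T -> R[i].

Definition cmeasurable f :=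
  measurable_fun setT (fun x => complex.Re (f x)) /\
  measurable_fun setT (fun x => complex.Im (f x)).

Lemma cmeasurableM f g : cmeasurable f -> cmeasurable g ->
  cmeasurable (fun x => f x * g x).
Proof.
move=> [rf jf] [rg jg]; split.
  apply: (eq_measurable_fun (fun x => complex.Re (f x) * complex.Re (g x) -
    complex.Im (f x) * complex.Im (g x))).
    by move=> x _; case: (f x) (g x) => [a b] [a' b'].
  by apply: measurable_funB; exact: measurable_funM.
apply: (eq_measurable_fun (fun x => complex.Re (f x) * complex.Im (g x) +
    complex.Im (f x) * complex.Re (g x))).
  by move=> x _; case: (f x) (g x) => [a b] [a' b'].
by apply: measurable_funD; exact: measurable_funM.
Qed.

Lemma cmeasurable_cst (c : R[i]) : cmeasurable (cst c).
Proof. by split. Qed.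

Lemma cmeasurable_sum n (f : 'I_n -> T -> R[i]) :
  (forall j, cmeasurable (f j)) -> cmeasurable (fun x => \sum_(j < n) f j x).
Proof.
elim: n f => [|n IH] f mf.
  by under eq_fun do rewrite big_ord0; exact: cmeasurable_cst.
have [rs js] := IH (fun j => f (widen_ord (leqnSn n) j)) (fun j => mf _).
have [rf jf] := mf ord_max.
under eq_fun do rewrite big_ord_recr.
split.
  apply: eq_measurable_fun (measurable_funD rs rf) => x _ /=.
  by case: (\sum_(i < n) _) (f ord_max x) => [a b] [a' b'].
apply: eq_measurable_fun (measurable_funD js jf) => x _ /=.
by case: (\sum_(i < n) _) (f ord_max x) => [a b] [a' b'].
Qed.

Lemma measurable_normc f : cmeasurable f ->
  measurable_fun setT (fun x => normc (f x)).
Proof.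
move=> [rf jf].
apply: (eq_measurable_fun (fun x =>
  (complex.Re (f x) ^+ 2 + complex.Im (f x) ^+ 2) `^ 2^-1)).
  move=> x _; case: (f x) => a b /=.
  by rewrite -powR12_sqrt// addr_ge0// sqr_ge0.
apply: (measurableT_comp (measurable_powR _)).
by apply: measurable_funD; exact: measurable_funX.
Qed.

Variable mu : {measure set T -> \bar R}.

Definition cintegrable f :=
  mu.-integrable setT (EFin \o (fun x => complex.Re (f x))) /\
  mu.-integrable setT (EFin \o (fun x => complex.Im (f x))).

Lemma le_cintegrable f (g : T -> R) : cmeasurable f ->
  (forall x, normc (f x) <= g x) -> mu.-integrable setT (EFin \o g) ->
  cintegrable f.
Proof.
move=> [rf jf] fg ig; split; apply: (le_integrable _ _ _ ig) => //.
- exact/measurable_EFinP.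
- move=> x _ /=; rewrite lee_fin.
  by rewrite (le_trans (ler_normc_Re _))// (le_trans (fg x))// ler_norm.
- exact/measurable_EFinP.
- move=> x _ /=; rewrite lee_fin.
  by rewrite (le_trans (ler_normc_Im _))// (le_trans (fg x))// ler_norm.
Qed.

(** The constant 2, from bounding real and imaginary parts separately, spares
    the rotation argument; constants do not matter for the theorem. *)
Lemma normc_cintegral_le f (g : T -> R) : cmeasurable f ->
  (forall x, normc (f x) <= g x) -> mu.-integrable setT (EFin \o g) ->
  normc (cintegral mu f) <= 2 * \int[mu]_x g x.
Proof.
move=> mf fg ig; have [ir ij] := le_cintegrable mf fg ig.
have g0 x : 0 <= g x by exact: le_trans (normc_ge0 _) (fg x).
apply: le_trans (ler_normc_ReIm _) _ => /=.
rewrite mulrDl mul1r lerD//.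
- apply: le_trans (le_normr_Rintegral _ ir) _ => //.
  apply: le_Rintegral => //; first exact: integrable_norm ir.
  by move=> x _; exact: le_trans (ler_normc_Re _) (fg x).
- apply: le_trans (le_normr_Rintegral _ ij) _ => //.
  apply: le_Rintegral => //; first exact: integrable_norm ij.
  by move=> x _; exact: le_trans (ler_normc_Im _) (fg x).
Qed.

Lemma cintegral_linear c f g : cintegrable f -> cintegrable g ->
  cintegrable (fun x => c * f x + g x) /\
  cintegral mu (fun x => c * f x + g x) = c * cintegral mu f + cintegral mu g.
Proof.
move=> [rf jf] [rg jg].
have ReE x : complex.Re (c * f x + g x) = complex.Re c * complex.Re (f x) +
    (- complex.Im c) * complex.Im (f x) + complex.Re (g x).
  by move: (c) (f x) (g x) => [u v] [a b] [a' b'] /=; rewrite mulNr.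
have ImE x : complex.Im (c * f x + g x) = complex.Re c * complex.Im (f x) +
    complex.Im c * complex.Re (f x) + complex.Im (g x).
  by move: (c) (f x) (g x) => [u v] [a b] [a' b'].
have Z r (h : T -> R) : mu.-integrable setT (EFin \o h) ->
  mu.-integrable setT (EFin \o (fun x => r * h x)).
  by move=> ih; apply: (eq_integrable _ _ _ _ (integrableZl measurableT r ih)).
have D (h k : T -> R) : mu.-integrable setT (EFin \o h) ->
  mu.-integrable setT (EFin \o k) ->
  mu.-integrable setT (EFin \o (fun x => h x + k x)).
  by move=> ih ik; apply: (eq_integrable _ _ _ _ (integrableD measurableT ih ik)).
split.
  by split; [under eq_fun do rewrite /= ReE|under eq_fun do rewrite /= ImE];
    apply: (D) => //; apply: (D); apply: (Z).
rewrite /cintegral; under eq_Rintegral do rewrite ReE.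
under [X in _ +i* X]eq_Rintegral do rewrite ImE.
rewrite !RintegralD//; try by [|apply: (Z)|apply: (D); apply: (Z)].
rewrite !RintegralZl//.
by move: (c) => [u v]; rewrite mulNr.
Qed.

End complex_measurability.

(** * Rudin-Shapiro polynomials *)

Section rudin_shapiro.

(** Parity of the number of occurrences of 11 in the binary expansion of [j];
    the recursion halves [j], so [j] itself is always enough fuel. *)
Fixpoint count11_parity (fuel j : nat) : bool :=
  if fuel is fuel'.+1 then (odd j && odd j./2) (+) count11_parity fuel' j./2
  else false.

Definition rudin_shapiro (j : nat) : bool := count11_parity j j.

Lemma count11_parity0 fuel : count11_parity fuel 0 = false.
Proof. by elim: fuel. Qed.

Lemma count11_parity_fuel fuel fuel' j : (j <= fuel)%N -> (j <= fuel')%N ->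
  count11_parity fuel j = count11_parity fuel' j.
Proof.
elim: fuel fuel' j => [|f IH] [|f'] j //=.
- by rewrite leqn0 => /eqP -> _; rewrite count11_parity0.
- by rewrite leqn0 => _ /eqP ->; rewrite count11_parity0.
- by move=> jf jf'; rewrite (IH f') //; lia.
Qed.

Lemma rudin_shapiro_double k : rudin_shapiro k.*2 = rudin_shapiro k.
Proof.
rewrite /rudin_shapiro (@count11_parity_fuel _ k.*2.+1 k.*2) //.
rewrite /= odd_double /= doubleK.
by apply: count11_parity_fuel; lia.
Qed.

Lemma rudin_shapiro_doubleS k :
  rudin_shapiro k.*2.+1 = odd k (+) rudin_shapiro k.
Proof.
rewrite /rudin_shapiro /= odd_double /= uphalf_double.
by congr (_ (+) _); apply: count11_parity_fuel; lia.
Qed.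

Lemma sum_double (V : nmodType) (F : nat -> V) n :
  \sum_(k < n.*2) F k = \sum_(k < n) (F k.*2 + F k.*2.+1).
Proof.
elim: n => [|n IH]; first by rewrite !big_ord0.
by rewrite doubleS !big_ord_recr /= IH addrA.
Qed.

Definition rs_poly {S : pzRingType} (n : nat) (z : S) : S :=
  \sum_(k < n) (-1) ^+ rudin_shapiro k * z ^+ k.

(** Separating even and odd indices turns the binary recursion of the signs
    into a recursion between z and z^2. *)
Lemma rs_poly_double (S : comPzRingType) n (z : S) :
  rs_poly n.*2 z = rs_poly n (z ^+ 2) + z * rs_poly n (- z ^+ 2).
Proof.
rewrite /rs_poly (sum_double (fun k => (-1) ^+ rudin_shapiro k * z ^+ k)).
rewrite big_split mulr_sumr /=; congr (_ + _); apply: eq_bigr => k _.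
  by rewrite rudin_shapiro_double -exprM mul2n.
rewrite rudin_shapiro_doubleS signr_addb signr_odd (exprNn (z ^+ 2)).
rewrite -exprM mul2n exprS.
ring.
Qed.

Context {R : realType}.
Implicit Types z w : R[i].

(** The parallelogram identity is what makes the recursion of the
    Rudin-Shapiro polynomials energy preserving. *)
Lemma normc_parallelogram z w :
  normc (z + w) ^+ 2 + normc (z - w) ^+ 2 = 2 * (normc z ^+ 2 + normc w ^+ 2).
Proof.
case: z w => [a b] [c d] /=.
by rewrite !sqr_sqrtr ?addr_ge0 ?sqr_ge0//; ring.
Qed.

(** By [rs_poly_double], P_{2N}(z) and P_{2N}(-z) are a + z b and a - z b with
    a = P_N(z^2) and b = P_N(-z^2), so the parallelogram identity doubles the
    energy at each step. *)
Lemma rs_poly_energy n z : normc z = 1 ->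
  normc (rs_poly (2 ^ n) z) ^+ 2 + normc (rs_poly (2 ^ n) (- z)) ^+ 2
  = 2 ^+ n.+1.
Proof.
elim: n z => [|n IH] z z1.
  rewrite expn0 /rs_poly !big_ord1 /rudin_shapiro !expr0 !mulr1.
  by rewrite normc1 expr1n expr1.
rewrite expnS mul2n !rs_poly_double sqrrN mulNr normc_parallelogram.
have z2 : normc (z ^+ 2) = 1 by rewrite expr2 normcM z1 mul1r.
by rewrite normcM z1 mul1r IH// -exprS.
Qed.

(** The sup norm on the circle is of the order of the square root of the
    number of terms, the best possible for unimodular coefficients. *)
Lemma normc_rs_poly n z : normc z = 1 ->
  normc (rs_poly (2 ^ n) z) <= Num.sqrt (2 ^+ n.+1).
Proof.
move=> z1; rewrite -(ger0_norm (normc_ge0 (rs_poly (2 ^ n) z))) -sqrtr_sqr.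
by rewrite ler_wsqrtr// -(rs_poly_energy n z1) lerDl sqr_ge0.
Qed.

End rudin_shapiro.

(** * Bounded bilinear forms and projective tensors *)

Section weighted_pairing.
Context {d : measure_display} {T : measurableType d} {R : realType}.
Variables (mu : {measure set T -> \bar R}) (p q : R).
Hypotheses (p0 : 0 < p) (q0 : 0 < q) (pq : p^-1 + q^-1 = 1).
Implicit Types f g m : T -> R[i].

(** Values of wavelet coefficients at the points (b, 1), and combinations of
    such values, have this form, with a trigonometric polynomial as [m]. *)
Definition pairing m f g : R[i] := cintegral mu (fun x => m x * f x * g x).

Section bounded_weight.
Variables (m : T -> R[i]) (M : R).
Hypotheses (M0 : 0 <= M) (mm : cmeasurable m) (mM : forall x, normc (m x) <= M).

(** Hoelder's inequality gives the integrable majorant of the weighted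
    product and the bound of its integral. *)
Lemma pairing_dominated f g : cLp mu p%:E f -> cLp mu q%:E g ->
  [/\ cmeasurable (fun x => m x * f x * g x),
      forall x, normc (m x * f x * g x) <= M * (normc (f x) * normc (g x)),
      mu.-integrable setT
        (EFin \o (fun x => M * (normc (f x) * normc (g x)))) &
      \int[mu]_x (M * (normc (f x) * normc (g x))) <=
        M * (fine (cLnorm mu p%:E f) * fine (cLnorm mu q%:E g))].
Proof.
move=> [rf jf Nf] [rg jg Ng].
have mnf : measurable_fun setT (fun x => normc (f x)) by exact: measurable_normc.
have mng : measurable_fun setT (fun x => normc (g x)) by exact: measurable_normc.
have Nf0 : (0 <= cLnorm mu p%:E f)%E by exact: Lnorm_ge0.
have Ng0 : (0 <= cLnorm mu q%:E g)%E by exact: Lnorm_ge0.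
have hol := hoelder mu mnf mng p0 q0 pq.
rewrite Lnorm1 /= in hol.
have hfin : (cLnorm mu p%:E f * cLnorm mu q%:E g < +oo)%E.
  by rewrite lte_mul_pinfty// ge0_fin_numE.
have ifg : mu.-integrable setT (EFin \o (fun x => normc (f x) * normc (g x))).
  apply/integrableP; split; first exact/measurable_EFinP/measurable_funM.
  exact: le_lt_trans hol hfin.
split.
- by do 2?apply: cmeasurableM.
- move=> x; rewrite !normcM -mulrA ler_wpM2r// mulr_ge0//; exact: normc_ge0.
- by have := integrableZl measurableT M ifg; apply: eq_integrable.
- rewrite RintegralZl//; apply: ler_wpM2l => //.
  rewrite -fineM ?ge0_fin_numE// fine_le//.
  + exact: integrable_fin_num.
  + by rewrite ge0_fin_numE// mule_ge0.
  + apply: le_trans hol; rewrite le_eqVlt; apply/orP; left; apply/eqP.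
    apply: eq_integral => x _ /=; congr EFin.
    by rewrite ger0_norm// mulr_ge0 ?normc_ge0.
Qed.

Lemma normc_pairing_le f g : cLp mu p%:E f -> cLp mu q%:E g ->
  normc (pairing m f g) <=
    2 * M * (fine (cLnorm mu p%:E f) * fine (cLnorm mu q%:E g)).
Proof.
move=> pf pg; have [mF leF iF normF] := pairing_dominated pf pg.
apply: le_trans (normc_cintegral_le mF leF iF) _.
by rewrite -mulrA ler_wpM2l.
Qed.

Lemma pairing_cintegrable f g : cLp mu p%:E f -> cLp mu q%:E g ->
  cintegrable mu (fun x => m x * f x * g x).
Proof.
move=> pf pg; have [mF leF iF _] := pairing_dominated pf pg.
exact: le_cintegrable leF iF.
Qed.

Lemma pairing_bilinear : bilinear_form mu p%:E q%:E (pairing m).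
Proof.
split.
- move=> c f f' g pf pf' pg; rewrite /pairing.
  have [_ <-] := cintegral_linear c (pairing_cintegrable pf pg)
    (pairing_cintegrable pf' pg).
  by congr cintegral; apply/funext => x; ring.
- move=> c f g g' pf pg pg'; rewrite /pairing.
  have [_ <-] := cintegral_linear c (pairing_cintegrable pf pg)
    (pairing_cintegrable pf pg').
  by congr cintegral; apply/funext => x; ring.
- move=> f g pf pg fg0; apply: (@eq0_normc R); apply/eqP.
  rewrite eq_le normc_ge0 andbT; apply: le_trans (normc_pairing_le pf pg) _.
  by case: fg0 => ->; rewrite ?mul0r !mulr0.
Qed.

End bounded_weight.

(** Linearity in the weight: a combination of evaluations is the pairing whose
    weight is the corresponding trigonometric polynomial, so that it is bounded
    by the sup norm of that polynomial. *)
Lemma pairing_sum n (a : 'I_n -> R[i]) (m : 'I_n -> T -> R[i]) (M : R) f g :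
  0 <= M -> (forall j, cmeasurable (m j)) ->
  (forall j x, normc (m j x) <= M) -> cLp mu p%:E f -> cLp mu q%:E g ->
  \sum_(j < n) a j * pairing (m j) f g =
  pairing (fun x => \sum_(j < n) a j * m j x) f g.
Proof.
move=> M0 mm mM pf pg; rewrite /pairing.
suff [] : cintegrable mu (fun x => (\sum_(j < n) a j * m j x) * f x * g x) /\
  cintegral mu (fun x => (\sum_(j < n) a j * m j x) * f x * g x) =
  \sum_(j < n) a j * pairing (m j) f g by [].
elim: n a m mm mM => [|n IH] a m mm mM.
  have -> : (fun x => (\sum_(j < 0) a j * m j x) * f x * g x) = cst 0.
    by apply/funext => x; rewrite big_ord0 !mul0r.
  rewrite big_ord0; split; first by split; exact: integrable0.
  by rewrite /cintegral /= /Rintegral integral0.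
have [ia Ea] := IH (a \o widen_ord (leqnSn n)) (m \o widen_ord (leqnSn n))
  (fun j => mm _) (fun j => mM _).
have im := pairing_cintegrable M0 (mm ord_max) (mM ord_max) pf pg.
have [il El] := cintegral_linear (a ord_max) im ia.
have E : (fun x => (\sum_(j < n.+1) a j * m j x) * f x * g x) =
  (fun x => a ord_max * (m ord_max x * f x * g x) +
   (\sum_(j < n) (a \o widen_ord (leqnSn n)) j *
      (m \o widen_ord (leqnSn n)) j x) * f x * g x).
  by apply/funext => x; rewrite big_ord_recr /=; ring.
rewrite E; split => //.
by rewrite El Ea big_ord_recr /= addrC.
Qed.

End weighted_pairing.

Section projective_bound.
Context {d : measure_display} {T : measurableType d} {R : realType}.
Variables (mu : {measure set T -> \bar R}) (p q : \bar R).

Lemma bilinear_form_sum n (a : 'I_n -> R[i])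
    (B : 'I_n -> (T -> R[i]) -> (T -> R[i]) -> R[i]) :
  (forall j, bilinear_form mu p q (B j)) ->
  bilinear_form mu p q (fun f g => \sum_(j < n) a j * B j f g).
Proof.
move=> bB; split.
- move=> c f f' g pf pf' pg.
  rewrite mulr_sumr -big_split; apply: eq_bigr => j _.
  by have [/(_ c f f' g pf pf' pg) -> _ _] := bB j; rewrite /=; ring.
- move=> c f g g' pf pg pg'.
  rewrite mulr_sumr -big_split; apply: eq_bigr => j _.
  by have [_ /(_ c f g g' pf pg pg') -> _] := bB j; rewrite /=; ring.
- move=> f g pf pg fg0; rewrite big1// => j _.
  by have [_ _ /(_ f g pf pg fg0) ->] := bB j; rewrite mulr0.
Qed.

(** A bounded bilinear form takes the same value on all representatives of a
    tensor; the bound is therefore inherited by the infimum defining the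
    projective norm. *)
Lemma normc_bilinear_le_projective_norm
    (B : (T -> R[i]) -> (T -> R[i]) -> R[i]) (K : R) s :
  0 <= K -> bilinear_form mu p q B ->
  (forall f g, cLp mu p f -> cLp mu q g ->
    normc (B f g) <= K * (fine (cLnorm mu p f) * fine (cLnorm mu q g))) ->
  is_tensor mu p q s ->
  normc (\sum_(z <- s) B z.1 z.2) <= K * projective_norm mu p q s.
Proof.
move=> K0 bB BK ts; rewrite /projective_norm.
set S := [set _ | _ in _].
have boundS t : is_tensor mu p q t -> tensor_equiv mu p q s t ->
  normc (\sum_(z <- s) B z.1 z.2) <=
  K * \sum_(z <- t) fine (cLnorm mu p z.1) * fine (cLnorm mu q z.2).
  move=> tt /(_ B bB) ->; elim: t tt => [|z t IH] tt.
    by rewrite !big_nil normc0 mulr0.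
  rewrite !big_cons mulrDr (le_trans (ler_normcD _ _))// lerD//.
    by have [pz qz] := tt z (mem_head _ _); exact: BK.
  by apply: IH => y yt; apply: tt; rewrite inE yt orbT.
have S0 : S !=set0 by eexists; exists s.
have [K_eq0|K_neq0] := eqVneq K 0.
  by have := boundS s ts (fun _ _ => erefl); rewrite K_eq0 !mul0r.
have K_gt0 : 0 < K by rewrite lt_neqAle eq_sym K_neq0.
rewrite -ler_pdivrMl//; apply: lb_le_inf => // _ [t [tt st] <-].
by rewrite ler_pdivrMl//; exact: boundS.
Qed.

Lemma cLpN f : cLp mu p f -> cLp mu p (fun x => - f x).
Proof.
move=> [rf jf Nf]; split.
- apply: (eq_measurable_fun (fun x => - complex.Re (f x))).
    by move=> x _; case: (f x).
  exact: measurable_funN.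
- apply: (eq_measurable_fun (fun x => - complex.Im (f x))).
    by move=> x _; case: (f x).
  exact: measurable_funN.
- rewrite /cLnorm (eq_Lnorm _ _ (g := fun x => (normc (f x))%:E))// => x.
  by rewrite normcN.
Qed.

Lemma is_tensor_sub s t : is_tensor mu p q s -> is_tensor mu p q t ->
  is_tensor mu p q (tensor_sub s t).
Proof.
move=> ts tt z; rewrite mem_cat => /orP[/ts //|/mapP[y /tt[py qy] ->]].
by split => //; exact: cLpN.
Qed.

(** The axioms of a bilinear form give B (- f) g = - B f g through
    - f = (- 2) f + f, without passing through the zero function. *)
Lemma bilinear_tensor_sub B s t : bilinear_form mu p q B ->
  is_tensor mu p q t -> \sum_(z <- tensor_sub s t) B z.1 z.2 =
  \sum_(z <- s) B z.1 z.2 - \sum_(z <- t) B z.1 z.2.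
Proof.
move=> [linB _ _] tt; rewrite /tensor_sub big_cat big_map -sumrN; congr (_ + _).
apply: eq_big_seq => -[f g] /tt[/= pf qg].
have -> : (fun x => - f x) = (fun x => (-2) * f x + f x).
  by apply/funext => x; ring.
by rewrite linB//; ring.
Qed.

(** Continuity of point evaluations on the range, uniformly over all their
    finite combinations: [C] plays the part of the quotient norm of [u].  It
    depends on [u] alone, because beyond one fixed index the terms of a Cauchy
    sequence are at projective distance less than 1 from each other, so that the
    values of every form bounded by [K] differ there by at most [K]. *)
Lemma projective_range_bounded (X : Type)
    (Phi : (T -> R[i]) -> (T -> R[i]) -> X -> R[i]) u :
  projective_range mu p q Phi u ->
  exists C : R, forall (n : nat) (a : 'I_n -> R[i]) (x : 'I_n -> X) (K : R),
    0 <= K ->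
    (forall j, bilinear_form mu p q (fun f g => Phi f g (x j))) ->
    (forall f g, cLp mu p f -> cLp mu q g ->
      normc (\sum_(j < n) a j * Phi f g (x j)) <=
      K * (fine (cLnorm mu p f) * fine (cLnorm mu q g))) ->
    normc (\sum_(j < n) a j * u (x j)) <= K * C.
Proof.
move=> [w [tw cw limw]].
have [N0 cauN0] := cw 1 ltr01.
exists (1 + projective_norm mu p q (w N0)) => n a x K K0 bx Kx.
pose L f g := \sum_(j < n) a j * Phi f g (x j).
have bL : bilinear_form mu p q L by exact: bilinear_form_sum.
apply/ler_addgt0Pr => e e0.
pose A := \sum_(j < n) normc (a j).
have A0 : 0 <= A by apply: sumr_ge0 => j _; exact: normc_ge0.
have eA : 0 < e / (A + 1) by rewrite divr_gt0// ltr_wpDl.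
have [N1 limN1] := limw _ eA.
pose m := maxn N0 N1.
have Lm : \sum_(z <- w m) L z.1 z.2 =
    \sum_(j < n) a j * \sum_(z <- w m) Phi z.1 z.2 (x j).
  by rewrite exchange_big; apply: eq_bigr => j _; rewrite mulr_sumr.
have -> : \sum_(j < n) a j * u (x j) =
    \sum_(j < n) a j * (u (x j) - \sum_(z <- w m) Phi z.1 z.2 (x j)) +
    (\sum_(z <- tensor_sub (w m) (w N0)) L z.1 z.2 +
     \sum_(z <- w N0) L z.1 z.2).
  have -> : \sum_(z <- tensor_sub (w m) (w N0)) L z.1 z.2 =
     \sum_(z <- w m) L z.1 z.2 - \sum_(z <- w N0) L z.1 z.2.
    by apply: bilinear_tensor_sub.
  rewrite subrK Lm -big_split; apply: eq_bigr => j _ /=; ring.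
apply: le_trans (ler_normcD _ _) _; rewrite [leRHS]addrC lerD//.
  apply: le_trans (ler_normc_sum _) _.
  apply: (@le_trans _ _ (\sum_(j < n) normc (a j) * (e / (A + 1)))).
    apply: ler_sum => j _; rewrite normcM ler_wpM2l ?normc_ge0//.
    by apply: limN1; exact: leq_maxr.
  rewrite -mulr_suml -/A mulrCA ler_piMr ?(ltW e0)//.
  rewrite ler_pdivrMr ?ltr_wpDl// mul1r.
  by rewrite lerDl.
apply: le_trans (ler_normcD _ _) _; rewrite mulrDr; apply: lerD.
  apply: le_trans (normc_bilinear_le_projective_norm K0 bL Kx _) _.
    exact: is_tensor_sub.
  by rewrite ler_wpM2l// ltW// cauN0// leq_maxl.
exact: normc_bilinear_le_projective_norm.
Qed.

End projective_bound.

(** A single elementary tensor is a constant Cauchy sequence. *)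
Lemma elementary_projective_range d (T : measurableType d) (R : realType)
    (mu : {measure set T -> \bar R}) (p q : \bar R) (X : Type)
    (Phi : (T -> R[i]) -> (T -> R[i]) -> X -> R[i]) f g :
  cLp mu p f -> cLp mu q g -> projective_range mu p q Phi (Phi f g).
Proof.
move=> pf qg; pose s := [:: (f, g)].
have ts : is_tensor mu p q s by move=> z; rewrite inE => /eqP ->.
exists (fun=> s); split => //.
  move=> e e0; exists 0%N => m n _ _; apply: le_lt_trans e0.
  rewrite /projective_norm; apply: ge_inf.
    exists 0 => _ [t _ <-]; apply: sumr_ge0 => z _.
    by rewrite mulr_ge0// fine_ge0// Lnorm_ge0.
  exists [::]; last by rewrite big_nil.
  split => [z //|B bB].
  by rewrite (bilinear_tensor_sub _ bB ts) subrr big_nil.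
move=> e e0; exists 0%N => n _ x.
by rewrite big_seq1 subrr normc0 ltW.
Qed.

(** * The Rudin-Shapiro bound for wavelet coefficients *)

Section obstruction.
Context {R : realType}.

Lemma hoelder_conjugateE (p : R) : 1 < p ->
  hoelder_conjugate p%:E = (p / (p - 1))%:E.
Proof.
move=> p1; rewrite /hoelder_conjugate /= eqe gt_eqF ?(lt_trans ltr01)//.
by rewrite -EFinB inver subr_eq0 gt_eqF.
Qed.

Lemma hoelder_conjugate_inv (p : R) : 1 < p -> p^-1 + (p / (p - 1))^-1 = 1.
Proof.
move=> p1; field; apply/andP; split; last by rewrite gt_eqF// (lt_trans ltr01).
by rewrite subr_eq0 gt_eqF.
Qed.

Lemma cisD (s t : R) : cis (s + t) = cis s * cis t.
Proof.
rewrite /cis cosD sinD; apply/eqP.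
by rewrite eq_complex /= eqxx addrC [_ * sin t]mulrC eqxx.
Qed.

Lemma cisX (t : R) n : cis t ^+ n = cis (t * n%:R).
Proof.
elim: n => [|n IH]; first by rewrite mulr0 /cis cos0 sin0.
by rewrite exprSr IH -cisD -natr1 mulrDr mulr1.
Qed.

Lemma normc_cis (t : R) : normc (cis t) = 1.
Proof. by rewrite /cis /= cos2Dsin2 sqrtr1. Qed.

Lemma measurable_fun_rval :
  measurable_fun setT (@rval R : rstar R -> measurableTypeR R).
Proof. by move=> _ B mB; rewrite setTI; exists B => //; rewrite setTI. Qed.

Lemma cmeasurable_cis (c : R) :
  cmeasurable (fun t : rstar R => cis (c * rval t)).
Proof.
split => /=.
  apply: (measurableT_comp (f := @cos R)).
    by apply: continuous_measurable_fun; exact: continuous_cos.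
  exact: measurable_funM _ measurable_fun_rval.
apply: (measurableT_comp (f := @sin R)).
  by apply: continuous_measurable_fun; exact: continuous_sin.
exact: measurable_funM _ measurable_fun_rval.
Qed.

Lemma wavelet_coef_translation (j : nat) (xi eta : rstar R -> R[i]) :
  wavelet_coef xi eta (j%:R, 1%g) =
  pairing haar_rstar (fun t => cis (2 * pi * rval t) ^+ j) xi eta.
Proof.
congr cintegral; apply/funext => t.
by rewrite /= mulg1 cisX; congr (cis _ * _ * _); ring.
Qed.

(** At the points (j, 1) the coefficient of xi and eta is the integral of
    cis (2 pi t)^j xi(t) eta(t), so the signed sum is the pairing weighted by the
    Rudin-Shapiro polynomial.  This is the bound that Fourier transforms of
    integrable functions satisfy. *)
Lemma A_pi_rudin_shapiro (p : R) (u : affine R -> R[i]) : 1 < p -> A_pi p u ->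
  exists C : R, forall n,
    normc (\sum_(j < 2 ^ n) (-1) ^+ rudin_shapiro j * u (j%:R, 1%g)) <=
    C * Num.sqrt (2 ^+ n).
Proof.
move=> p1 Au; have p0 : 0 < p by exact: lt_trans ltr01 p1.
have q0 : 0 < p / (p - 1) by rewrite divr_gt0// subr_gt0.
have pq := hoelder_conjugate_inv p1.
move: Au; rewrite /A_pi (hoelder_conjugateE p1).
move=> /projective_range_bounded[C bC].
exists (2 * Num.sqrt 2 * C) => n.
have mcis j : cmeasurable (fun t : rstar R => cis (2 * pi * rval t) ^+ j).
  under eq_fun do rewrite cisX mulrAC.
  exact: cmeasurable_cis.
have cis1 j (t : rstar R) : normc (cis (2 * pi * rval t) ^+ j) <= 1.
  by rewrite cisX normc_cis.
apply: le_trans (bC _ (fun j : 'I_(2 ^ n) => (-1) ^+ rudin_shapiro j)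
  (fun j => (j%:R, 1%g)) (2 * Num.sqrt (2 ^+ n.+1)) _ _ _) _.
- by rewrite mulr_ge0// sqrtr_ge0.
- move=> j; rewrite (_ : (fun f g => _) =
    pairing haar_rstar (fun t => cis (2 * pi * rval t) ^+ j)).
    exact: (pairing_bilinear haar_rstar p0 q0 pq ler01).
  by apply/funext => f; apply/funext => g; rewrite wavelet_coef_translation.
- move=> f g pf pg.
  under eq_bigr do rewrite wavelet_coef_translation.
  rewrite (pairing_sum p0 q0 pq _ ler01)//.
  apply: (normc_pairing_le p0 q0 pq) => //.
  + apply: cmeasurable_sum => j.
    exact: cmeasurableM (cmeasurable_cst _) (mcis j).
  + by move=> t; apply: normc_rs_poly; exact: normc_cis.
- by rewrite exprS sqrtrM// mulrA [leRHS]mulrAC.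
Qed.

End obstruction.

(** * Weights constant on dyadic blocks *)

Section dyadic_weights.
Context {R : realType}.
Implicit Types (t : R) (n : nat).

(** The index 0 gives the term 1, and the block [2^i, 2^(i+1)), on which the
    weight is t^i, gives (2 t)^i. *)
Lemma sum_expr_trunc_log t n :
  \sum_(j < 2 ^ n) t ^+ trunc_log 2 j = 1 + \sum_(i < n) (2 * t) ^+ i.
Proof.
elim: n => [|n IH].
  by rewrite expn0 big_ord1 big_ord0 /= trunc_log0 expr0 addr0.
rewrite big_ord_recr /= addrA -IH expnS mul2n -addnn big_split_ord /=.
congr (_ + _); rewrite exprMn -natrX.
rewrite (eq_bigr (fun _ => t ^+ n)) => [|j _].
  by rewrite sumr_const card_ord mulr_natl.
congr (_ ^+ _); apply: trunc_log_eq => //.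
by rewrite leq_addr expnS mul2n -addnn ltn_add2l /=.
Qed.

Lemma sum_expr_trunc_log_le t n : 0 <= t -> 2 * t < 1 ->
  \sum_(j < n) t ^+ trunc_log 2 j <= 1 + (1 - 2 * t)^-1.
Proof.
move=> t0 t1.
have x0 : 0 <= 2 * t by rewrite mulr_ge0.
have le2n : (n <= 2 ^ n)%N by rewrite ltnW// ltn_expl.
apply: (@le_trans _ _ (\sum_(j < 2 ^ n) t ^+ trunc_log 2 j)).
  rewrite (big_ord_widen _ (fun j => t ^+ trunc_log 2 j) le2n).
  rewrite [leRHS](bigID (fun j : 'I_(2 ^ n) => (j < n)%N)) /= lerDl.
  by apply: sumr_ge0 => j _; exact: exprn_ge0.
rewrite sum_expr_trunc_log lerD2l -[leRHS]mul1r ler_pdivlMr ?subr_gt0//.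
by rewrite mulrC -opprB mulNr -subrX1 opprB gerBl exprn_ge0.
Qed.

Lemma sum_expr_trunc_log_ge t n : 0 <= t <= 1 ->
  (2 * t) ^+ n <= \sum_(j < 2 ^ n) t ^+ trunc_log 2 j.
Proof.
move=> t01; rewrite exprMn -natrX mulr_natl -[in leLHS](card_ord (2 ^ n)).
rewrite -sumr_const; apply: ler_sum => j _.
have [j0|j0] := posnP j.
  by rewrite j0 trunc_log0 expr0; case/andP: t01 => *; exact: exprn_ile1.
case/andP: t01 => t0 t1; apply: ler_wiXn2l => //.
rewrite ltnW// -(ltn_exp2l _ _ (isT : 1 < 2)%N).
by rewrite (leq_ltn_trans (trunc_logP _ j0)).
Qed.

Lemma bernoulli_ineq t n : 0 <= t -> 1 + t * n%:R <= (1 + t) ^+ n.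
Proof.
move=> t0; elim: n => [|n IH]; first by rewrite mulr0 addr0 expr0.
rewrite exprS; apply: (@le_trans _ _ ((1 + t) * (1 + t * n%:R))); last first.
  by rewrite ler_wpM2l// addr_ge0.
rewrite -subr_ge0 (_ : _ - _ = t ^+ 2 * n%:R) ?mulr_ge0 ?sqr_ge0//.
by rewrite -natr1; ring.
Qed.

Lemma expr_unbounded t (C : R) : 1 < t -> exists n, C < t ^+ n.
Proof.
move=> t1; have h0 : 0 < t - 1 by rewrite subr_gt0.
exists (Num.trunc (`|C| / (t - 1))).+1.
apply: (@lt_le_trans _ _ (1 + (t - 1) * (Num.trunc (`|C| / (t - 1))).+1%:R)).
  rewrite (le_lt_trans (ler_norm C))// ltr_pwDl// -ler_pdivrMl// mulrC.
  by rewrite ltW// truncnS_gt.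
rewrite -{3}(subrKC 1 t); exact/bernoulli_ineq/ltW.
Qed.

(** With r = 2^(-c) the two conditions read c < 1/2 and c s > 1, hence the
    room between 1/s and 1/2 exactly when s > 2; the proof takes the midpoint. *)
Lemma exists_decay_rate (s : R) : 2 < s ->
  exists r : R, [/\ 0 < r, r <= 1, 1 < 2 * r ^+ 2 & 2 * r `^ s < 1].
Proof.
move=> s2; have s0 : 0 < s by exact: lt_trans s2.
pose c := (s + 2) / (4 * s).
have c0 : 0 < c by rewrite divr_gt0 ?addr_gt0 ?mulr_gt0.
have pow2 (x : R) : 2 * 2 `^ x = 2 `^ (1 + x) :> R.
  by rewrite powRD ?powRr1// pnatr_eq0 implybT.
have gt1 (x : R) : 0 < x -> 1 < 2 `^ x.
  move=> x0; have := @gt0_ltr_powR _ _ x0 1 2.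
  by rewrite powR1; apply; rewrite ?nnegrE ?ltr1n.
exists (2 `^ (- c)); split.
- exact: powR_gt0.
- by rewrite -[leRHS](powRr0 2) ler_powR ?ler1n// oppr_le0 ltW.
- rewrite -powR_mulrn ?powR_ge0// -powRrM pow2 gt1// mulNr subr_gt0 /c.
  by rewrite mulrAC ltr_pdivrMr ?mulr_gt0// mul1r; lra.
- rewrite -powRrM pow2 mulNr -opprB powRN invf_lt1 ?powR_gt0// gt1//.
  by rewrite subr_gt0 /c mulrAC ltr_pdivlMr ?mulr_gt0// mul1r; nra.
Qed.

End dyadic_weights.

(** * Step functions on the affine group *)

Section step_functions.
Context {R : realType}.
Implicit Types (c : int -> R) (y : affine R) (k : int).

(** The boxes [k, k+1) x [1, 2] are the translates of one of them by the
    integers (k, 1), and have therefore the same left Haar measure. *)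
Definition box k : set (affine R) :=
  [set y | Num.floor (y.1 : R) = k /\ 1 <= rval y.2 <= 2].

Definition step c y : R :=
  if 1 <= rval y.2 <= 2 then c (Num.floor (y.1 : R)) else 0.

Lemma step_box c k y : box k y -> step c y = c k.
Proof. by move=> [<- y2]; rewrite /step y2. Qed.

Lemma measurable_box k : measurable (box k).
Proof.
rewrite (_ : box k = `[k%:~R, (k + 1)%:~R[%classic `*`
    (@rval R : rstar R -> measurableTypeR R) @^-1` `[1, 2]%classic).
  apply: measurableX; first exact: measurable_itv.
  by rewrite -[X in measurable X]setTI; exact: measurable_fun_rval.
apply/seteqP; split => -[b a] /= [].
  by move=> /eqP; rewrite floor_eq in_itv /= => ? ?; split.
rewrite in_itv /= -floor_eq => /eqP bk; rewrite /preimage /= in_itv.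
by split.
Qed.

Lemma affine_coord_box0 :
  affine_coord @` box 0 = (`[0, 1[ `*` `[1, 2])%classic :>
    set (measurableTypeR R * measurableTypeR R).
Proof.
apply/seteqP; split.
  move=> _ [[b a] [/= /eqP]] + a12 <-; rewrite floor_eq => b01.
  by split; rewrite /= in_itv.
move=> [b a] [/=]; rewrite !in_itv /= => b01 a12.
have a0 : a != 0 by rewrite gt_eqF//; case/andP: a12 => /(lt_le_trans ltr01).
exists (b, Rstar a0) => //; split => //=.
by apply/eqP; rewrite floor_eq.
Qed.

Lemma translate_box (k : int) :
  [set (((k%:~R, 1%g) : affine R) * y)%g | y in box 0] = box k.
Proof.
apply/seteqP; split.
  move=> _ [[b a] [/= /eqP]] + a12 <-; rewrite floor_eq => /andP[b0 b1].
  split; last by rewrite /= mul1r.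
  apply/eqP; rewrite /= mul1r floor_eq lerDr b0 /= intrD addrC ltrD2l.
  exact: b1.
move=> [b a] [/= /eqP]; rewrite floor_eq => /andP[b0 b1] a12.
exists (b - k%:~R, a).
  split => //=; apply/eqP; rewrite floor_eq subr_ge0 b0 /= ltrBlDr.
  by rewrite addrC -intrD.
congr pair => /=; last exact: mul1g.
by rewrite mul1r subrK.
Qed.

Lemma haar_box k : haar_affine (box k) = haar_affine (box 0).
Proof.
by rewrite -translate_box haar_affine_left_invariant//; exact: measurable_box.
Qed.

Definition box_mass : R := fine (haar_affine (box 0)).

(** The density 1/a^2 lies between 1/4 and 1 for a in [1, 2], while the box
    has Lebesgue measure 1. *)
Lemma haar_box0_bounds :
  (4^-1%:E <= haar_affine (box 0))%E /\ (haar_affine (box 0) <= 1%:E)%E.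
Proof.
pose D := (`[0, 1[ `*` `[1, 2])%classic :
  set (measurableTypeR R * measurableTypeR R).
have mD : measurable D by apply: measurableX; exact: measurable_itv.
have leD : (lebesgue_measure \x lebesgue_measure)%E D = 1%E.
  transitivity (lebesgue_measure (`[0%R, 1%R[%classic : set R) *
      lebesgue_measure (`[1%R, 2%R]%classic : set R))%E.
    by apply: product_measure1E; exact: measurable_itv.
  rewrite !lebesgue_measure_itv /= !lte_fin ltr01 ltr1n -!EFinB -EFinM.
  by congr EFin; ring.
have mw : measurable_fun D
    (fun z : measurableTypeR R * measurableTypeR R => ((z.2 ^+ 2)^-1)%:E).
  apply: measurable_funTS; apply/measurable_EFinP; apply: measurable_invr_ge0.
    by move=> z; exact: sqr_ge0.
  by apply: measurable_funX; exact: measurable_snd.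
rewrite /haar_affine /weighted_image affine_coord_box0 -/D; split.
  rewrite -[leLHS]mule1 -leD -integral_cst//.
  apply: ge0_le_integral => //.
  - by move=> z _; rewrite lee_fin invr_ge0.
  - move=> z [_ /=]; rewrite in_itv /= => /andP[z1 z2].
    by rewrite lee_fin ler_pV2 ?inE ?unitfE; nra.
rewrite (_ : 1%:E = 1%:E * (lebesgue_measure \x lebesgue_measure)%E D)%E;
  last by rewrite leD mule1.
rewrite -integral_cst//; apply: ge0_le_integral => //.
- by move=> z _; rewrite lee_fin invr_ge0 sqr_ge0.
- move=> z [_ /=]; rewrite in_itv /= => /andP[z1 z2].
  by rewrite /= lee_fin invf_le1; nra.
Qed.

Lemma box_massE k : haar_affine (box k) = box_mass%:E.
Proof.
rewrite haar_box /box_mass fineK//; have [_ ub] := haar_box0_bounds.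
by rewrite ge0_fin_numE// (le_lt_trans ub)// ltry.
Qed.

Lemma box_mass_gt0 : 0 < box_mass.
Proof.
have [lb _] := haar_box0_bounds; rewrite -lte_fin -(box_massE 0).
by rewrite (lt_le_trans _ lb)// lte_fin invr_gt0.
Qed.

(** Left translation by (k, 1) acts on the first coordinate only, by an
    ordinary shift; this is how the translations of the line appear inside the
    regular representation of the affine group. *)
Lemma step_translate c k y :
  step c (((k%:~R, 1%g) : affine R)^-1 * y)%g = step (fun l => c (l - k)) y.
Proof.
case: y => b a; rewrite /step /=.
have -> : (@rval R (1%g : rstar R))^-1 = 1 by rewrite invr1.
by rewrite !mul1r -intrN floorDrz ?intr_int// intrKfloor.
Qed.


(** One half of the integers: the cases p < 2 and p > 2 need coefficients
    supported on the nonnegative and on the nonpositive integers. *)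
Definition side (b : bool) (j : nat) : int := (-1) ^+ b * j%:Z.

Lemma side_inj b : injective (side b).
Proof. by case: b => i j; rewrite /side ?expr0 ?expr1; lia. Qed.

Section one_sided.
Variables (b : bool) (c : int -> R).
Hypothesis suppc : forall k, c k != 0 -> exists j, k = side b j.

Let U := \bigcup_j box (side b j).

Let mU : measurable U.
Proof. by apply: bigcup_measurable => j _; exact: measurable_box. Qed.

Let step0 y : ~ U y -> step c y = 0.
Proof.
rewrite /step; case: ifPn => // y2 Uy; apply/eqP.
apply: contra_notT Uy => /suppc[j kj].
by exists j.
Qed.

Lemma measurable_step : measurable_fun setT (step c).
Proof.
rewrite -(setUv U); apply/measurable_funU => //; first exact: measurableC.
split.
  apply/measurable_fun_bigcup => j; first exact: measurable_box.
  apply: (eq_measurable_fun (cst (c (side b j)))) => [y|];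
    last exact: measurable_cst.
  by rewrite inE => yj; rewrite (step_box _ yj).
apply: (eq_measurable_fun (cst (0 : R))) => [y|]; last exact: measurable_cst.
by rewrite inE => Uy; rewrite step0.
Qed.

Let trivIset_box : trivIset setT (fun j => box (side b j)).
Proof.
move=> i j _ _ [y [[yi _] [yj _]]]; apply: (@side_inj b).
by rewrite -yi -yj.
Qed.

Lemma integral_step_power (s : R) : 0 < s ->
  (\int[haar_affine]_y (`|step c y|%:E `^ s) =
   \sum_(j <oo) (`|c (side b j)| `^ s * box_mass)%:E)%E.
Proof.
move=> s0.
transitivity (\int[haar_affine]_(y in U) (`|step c y| `^ s)%:E)%E.
  rewrite [RHS]integral_mkcond; apply: eq_integral => y _.
  rewrite poweR_EFin /patch; case: ifPn => //; rewrite notin_setE => /step0 ->.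
  by rewrite normr0 powR0// gt_eqF.
have mf : measurable_fun U (fun y => (`|step c y| `^ s)%:E).
  apply: measurable_funTS; apply/measurable_EFinP.
  apply: (measurableT_comp (measurable_powR s)).
  by apply: measurableT_comp => //; exact: measurable_step.
rewrite (ge0_integral_bigcup haar_affine
  (fun j => measurable_box (side b j)) mf)//.
apply: eq_eseriesr => j _.
transitivity (\int[haar_affine]_(y in box (side b j))
  (cst (`|c (side b j)| `^ s)%:E y))%E.
  by apply: eq_integral => y; rewrite inE => yj; rewrite /= (step_box _ yj).
rewrite EFinM -(box_massE (side b j)).
exact: (integral_cst haar_affine (measurable_box _)).
Qed.

Lemma step_cLp (s S : R) : 0 < s ->
  (forall n, \sum_(j < n) `|c (side b j)| `^ s <= S) ->
  cLp haar_affine s%:E (fun y => (step c y)%:C).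
Proof.
move=> s0 bS; split => /=; [exact: measurable_step|exact: measurable_cst|].
rewrite /cLnorm unlock; apply: poweR_lty.
rewrite (eq_integral (fun y => (`|step c y|%:E `^ s)%E)) => [|y _]; last first.
  congr (_ `^ _)%E; congr EFin.
  by rewrite /= expr0n addr0 sqrtr_sqr normr_id.
rewrite integral_step_power//.
apply: (@le_lt_trans _ _ (S * box_mass)%:E); last exact: ltry.
apply: lime_le.
  apply: is_cvg_nneseries => j _ _.
  by rewrite lee_fin mulr_ge0 ?powR_ge0// ltW// box_mass_gt0.
apply: nearW => n; rewrite sumEFin lee_fin -mulr_suml.
rewrite ler_wpM2r ?(ltW box_mass_gt0)//.
by rewrite big_mkord.
Qed.

End one_sided.

(** If one of the two step functions lives on the box of index 0 only, as in the
    counterexample, then the product under the integral lives on a single box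
    for every [k], and the coefficients of the other can be read off. *)
Lemma step_regular_coef c c' (k l : int) :
  (forall m, m != l -> c (m - k) * c' m = 0) ->
  regular_coef (fun y => (step c y)%:C) (fun y => (step c' y)%:C) (k%:~R, 1%g) =
  (c (l - k) * c' l * box_mass)%:C.
Proof.
move=> cc'.
have E y : (step c (((k%:~R, 1%g) : affine R)^-1 * y)%g)%:C * (step c' y)%:C =
    ((c (l - k) * c' l) * \1_(box l) y)%:C :> R[i].
  rewrite -rmorphM /=; congr (_ %:C); rewrite step_translate indicE.
  have [/set_mem yl|] := boolP (y \in box l).
    by rewrite !(step_box _ yl) mulr1.
  rewrite notin_setE /step mulr0; case: ifPn => y2 yl; last by rewrite mulr0.
  by apply: cc'; apply: contra_notN yl => /eqP.
rewrite /regular_coef /cintegral.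
under eq_Rintegral do rewrite E /=.
under [X in _ +i* X]eq_Rintegral do rewrite E /=.
have int1 : (\int[haar_affine]_y (\1_(box l) y)%:E = box_mass%:E)%E.
  rewrite -(box_massE l) -[in RHS](setIT (box l)).
  exact: (integral_indic haar_affine measurableT (measurable_box l)).
rewrite Rintegral_cst// mul0r RintegralZl//; first by rewrite /Rintegral int1.
apply/integrableP; split.
  by apply/measurable_EFinP/measurable_indicP; exact: measurable_box.
rewrite (eq_integral (fun y => (\1_(box l) y)%:E)) ?int1 ?ltry// => y _.
by rewrite gee0_abs// lee_fin.
Qed.

End step_functions.

(** * The counterexample *)

Section counterexample.
Context {R : realType}.

(** The signs cancel against those of the Rudin-Shapiro sum, which is then at
    least a constant times (2r)^n; since 2 r^2 > 1 this outgrows the bound of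
    order 2^(n/2) that membership imposes. *)
Lemma rudin_shapiro_not_A_pi (p r : R) (u : affine R -> R[i]) :
  1 < p -> 0 < r -> r <= 1 -> 1 < 2 * r ^+ 2 ->
  (forall j : nat, u (j%:R, 1%g) =
    ((-1) ^+ rudin_shapiro j * r ^+ trunc_log 2 j * box_mass)%:C) ->
  ~ A_pi p u.
Proof.
move=> p1 r0 r1 r2 uE /(A_pi_rudin_shapiro p1)[C bC].
have m0 := @box_mass_gt0 R.
have [n] := expr_unbounded ((C / box_mass) ^+ 2) r2; apply/negP; rewrite -leNgt.
have low : (2 * r) ^+ n * box_mass <= C * Num.sqrt (2 ^+ n).
  apply: le_trans (bC n); under eq_bigr do rewrite uE.
  have -> : \sum_(j < 2 ^ n) (-1) ^+ rudin_shapiro j *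
      ((-1) ^+ rudin_shapiro j * r ^+ trunc_log 2 j * box_mass)%:C =
      ((\sum_(j < 2 ^ n) r ^+ trunc_log 2 j) * box_mass)%:C :> R[i].
    rewrite mulr_suml rmorph_sum; apply: eq_bigr => j _.
    by rewrite -mulrA rmorphM rmorphXn rmorphN1 signrMK.
  rewrite /= expr0n addr0 sqrtr_sqr; apply: le_trans (ler_norm _).
  by rewrite ler_wpM2r ?(ltW m0)// sum_expr_trunc_log_ge// (ltW r0).
have pos : 0 <= (2 * r) ^+ n * box_mass.
  by rewrite mulr_ge0 ?(ltW m0)// exprn_ge0// mulr_ge0// ltW.
have sq : ((2 * r) ^+ n * box_mass) ^+ 2 <= C ^+ 2 * 2 ^+ n.
  rewrite -(sqr_sqrtr (exprn_ge0 n (ler0n R 2))) -exprMn.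
  by rewrite ler_sqr ?nnegrE// (le_trans pos low).
rewrite expr_div_n ler_pdivlMr ?exprn_gt0//.
rewrite -(@ler_pM2r _ (2 ^+ n)) ?exprn_gt0//.
apply: le_trans sq; rewrite le_eqVlt; apply/orP; left; apply/eqP.
rewrite mulrAC -exprMn (_ : 2 * r ^+ 2 * 2 = (2 * r) ^+ 2); last by ring.
by rewrite exprAC -exprMn.
Qed.

Definition rs_weights (r : R) (k : int) : R :=
  if k is Posz j then (-1) ^+ rudin_shapiro j * r ^+ trunc_log 2 j else 0.

Definition delta0 (k : int) : R := (k == 0)%:R.

Lemma delta0_cLp (s : R) : 0 < s ->
  cLp haar_affine s%:E (fun y => (step delta0 y)%:C).
Proof.
move=> s0; apply: (@step_cLp _ false _ _ _ 1) => //.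
  move=> k; rewrite /delta0; have [-> _|_] := eqVneq k 0; last by rewrite eqxx.
  by exists 0%N.
case=> [|n]; first by rewrite big_ord0.
rewrite big_ord_recl big1 ?addr0 => [|j _]; last first.
  by rewrite /delta0 /side expr0 mul1r /= normr0 powR0// gt_eqF.
by rewrite /delta0 /side mulr0 eqxx normr1 powR1.
Qed.

Lemma rs_weights_cLp (b : bool) (s r : R) : 0 < s -> 0 < r ->
  2 * r `^ s < 1 ->
  cLp haar_affine s%:E
    (fun y => (step (fun k => rs_weights r ((-1) ^+ b * k)) y)%:C).
Proof.
move=> s0 r0 rs.
apply: (@step_cLp _ b _ _ _ (1 + (1 - 2 * r `^ s)^-1)) => //.
  move=> k; rewrite /rs_weights; case E : (_ * k) => [j|j]; last by rewrite eqxx.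
  by exists j; rewrite /side -E signrMK.
move=> n; apply: le_trans (sum_expr_trunc_log_le n (powR_ge0 r s) rs).
apply: ler_sum => j _; rewrite /side signrMK /=.
rewrite normrM normrX normrN1 expr1n mul1r.
rewrite ger0_norm ?exprn_ge0 ?(ltW r0)// -!powR_mulrn ?powR_ge0 ?(ltW r0)//.
by rewrite powRAC.
Qed.

End counterexample.

Theorem theorem6p6 (R : realType) (p : R) (hp : (1 < p < 2) \/ (2 < p)) :
  ~ (figa_talamanca_herz p `<=` A_pi p).
Proof.
have p1 : 1 < p by case: hp => [/andP[]//|]; exact: lt_trans (ltr1n _ 2).
have p0 : 0 < p by exact: lt_trans ltr01 p1.
have q0 : 0 < p / (p - 1) by rewrite divr_gt0// subr_gt0.
move=> sub; case: hp => [/andP[_ p2]|p2].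
  (* p < 2: the conjugate exponent exceeds 2, and the second function carries
     the Rudin-Shapiro weights. *)
  have q2 : 2 < p / (p - 1) by rewrite ltr_pdivlMr ?subr_gt0//; lra.
  have [r [r0 r1 r2 rq]] := exists_decay_rate q2.
  have hL := rs_weights_cLp false q0 r0 rq.
  have fL := delta0_cLp p0.
  have Ap := elementary_projective_range regular_coef fL hL.
  rewrite -(hoelder_conjugateE p1) in Ap.
  apply: (rudin_shapiro_not_A_pi p1 r0 r1 r2 _ (sub _ Ap)) => j.
  rewrite -[j%:R]/(j%:~R) (@step_regular_coef _ _ _ _ j%:Z).
    by rewrite /delta0 subrr eqxx mul1r expr0 mul1r.
  by move=> m mj; rewrite /delta0 subr_eq0 (negbTE mj) mul0r.
(* p > 2: the first function carries them, reflected because the translation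
   acts on it. *)
have [r [r0 r1 r2 rp]] := exists_decay_rate p2.
have fL := rs_weights_cLp true p0 r0 rp.
have hL := delta0_cLp q0.
have Ap := elementary_projective_range regular_coef fL hL.
rewrite -(hoelder_conjugateE p1) in Ap.
apply: (rudin_shapiro_not_A_pi p1 r0 r1 r2 _ (sub _ Ap)) => j.
rewrite -[j%:R]/(j%:~R) (@step_regular_coef _ _ _ _ 0).
  by rewrite /delta0 eqxx mulr1 sub0r expr1 mulN1r opprK.
by move=> m m0; rewrite /delta0 (negbTE m0) mulr0.
Qed.
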